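(* Let $n\ge1$. If $\mathcal{F}\subseteq\{0,1,2\}^n$ is $3$-multisum $2$-intersecting, then $|\mathcal{F}|\le\left|\bigcup_{r=n+1}^{2n}2(n,r)\right|$.
   Context: $2(n,r)$ denotes the set of vectors in $\{0,1,2\}^n$ whose entries sum to $r$. For $\mathbf{x},\mathbf{y}\in\{0,1,2\}^n$, $|\mathbf{x}\cap_{m,3}\mathbf{y}|=\sum_{i=1}^n\max\{0,x_i+y_i-2\}$; a family $\mathcal{F}$ is $3$-multisum $2$-intersecting if $|\mathbf{x}\cap_{m,3}\mathbf{y}|\ge2$ for any $\mathbf{x},\mathbf{y}\in\mathcal{F}$. *)

(* Defs.v *)
From mathcomp Require Import all_boot.

Set Implicit Arguments.
Unset Strict Implicit.
Unset Printing Implicit Defensive.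

Notation vec3 n := {ffun 'I_n -> 'I_3}.

(* The set written 2(n, r). *)
Definition layer2 (n r : nat) : {set vec3 n} :=
  [set x : vec3 n | \sum_(i < n) (x i : nat) == r].

(* Subtraction on nat is truncated, so each summand is max{0, x_i + y_i - 2}. *)
Definition msum3_inter (n : nat) (x y : vec3 n) : nat :=
  \sum_(i < n) ((x i : nat) + (y i : nat) - 2).

(* x and y are not required to be distinct. *)
Definition msum3_intersecting (t n : nat) (F : {set vec3 n}) : Prop :=
  forall x y : vec3 n, x \in F -> y \in F -> t <= msum3_inter x y.

(* Main.v *)
Require Import Defs.
From mathcomp Require Import all_boot all_fingroup.
From mathcomp Require Import zify.

Set Implicit Arguments.
Unset Strict Implicit.
Unset Printing Implicit Defensive.

(** Swapping coordinates [i < j] of those [x] with [x i < x j] (when the result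
    is not already present) preserves the size of a family and the intersection
    property, so [F] may be assumed closed under such swaps.  In a closed
    family every [x] has a prefix whose entries sum to more than its length:
    otherwise each entry 2 can be matched with an earlier entry 0, and
    exchanging all matched pairs yields a member disjoint from [x].  Such [x]
    lie in the domain of the injective sl_2-crystal lowering operator, which
    decreases a single entry by one.  The complement of the lowered vector
    meets [x] in 1, hence is not in [F]; this injects the members of [F] of
    sum at most [n] into the non-members of sum at least [n + 1]. *)

(** * The lowering operator *)

(* Twice the maximal height of the walk with steps [x_i - 1], where an entry 1
   is read as half a step up followed by half a step down. *)
Fixpoint peak (s : seq nat) : nat :=
  match s with
  | [::] => 0
  | 0 :: s' => peak s' - 2
  | 1 :: s' => maxn 1 (peak s')
  | _ :: s' => (peak s').+2
  end.

(* Lowers the entry at which the walk first attains its maximum. *)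
Fixpoint lower (s : seq nat) : seq nat :=
  match s with
  | [::] => [::]
  | 0 :: s' => 0 :: lower s'
  | 1 :: s' => if peak s' <= 1 then 0 :: s' else 1 :: lower s'
  | a :: s' => if peak s' == 0 then 1 :: s' else a :: lower s'
  end.

(* Inverse of [lower]: raises the entry at which the walk last attains its
   maximum. *)
Fixpoint raise (s : seq nat) : seq nat :=
  match s with
  | [::] => [::]
  | 0 :: s' => if peak s' <= 1 then 1 :: s' else 0 :: raise s'
  | 1 :: s' => if peak s' == 0 then 2 :: s' else 1 :: raise s'
  | a :: s' => a :: raise s'
  end.

Definition ternary : pred (seq nat) := all (fun a => a <= 2).

Lemma size_lower s : size (lower s) = size s.
Proof.
by elim: s => [|[|[|a]] s IH] //=; rewrite -?IH //; case: ifP => //= _; rewrite IH.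
Qed.

Lemma peak_lower s : 0 < peak s -> peak (lower s) = (peak s).-1.
Proof.
elim: s => [|[|[|a]] s IH] //= H; first by rewrite IH; lia.
  by case: ifP => /= Hp; [lia | rewrite IH; lia].
case: eqP => /= Hp; first by rewrite Hp.
by rewrite IH; lia.
Qed.

(** Lowering an entry pulls all later heights down by a full step, but the maximum by only half a
    step. So the new maximum is last attained at the lowered entry, which is where [raise] acts. *)
Lemma lowerK s : ternary s -> 0 < peak s -> raise (lower s) = s.
Proof.
elim: s => [|[|[|[|a]]] s IH] //= Hs H.
- by rewrite peak_lower ?IH //; [case: ifP => //; lia | lia | lia].
- case: ifP => /= Hp; first by rewrite Hp.
  by rewrite peak_lower ?IH //; [case: ifP => //; lia | lia | lia].
case: eqP => /= Hp; first by rewrite Hp.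
by rewrite IH //; lia.
Qed.

Lemma nth_lower_le s k : nth 0 (lower s) k <= nth 0 s k.
Proof.
elim: s k => [|[|[|a]] s IH] [|k] //=.
- by case: ifP.
- by case: ifP => //= _; apply: IH.
- by case: ifP.
- by case: ifP => //= _; apply: IH.
Qed.

Lemma sumn_lower s : ternary s -> 0 < peak s -> (sumn (lower s)).+1 = sumn s.
Proof.
elim: s => [|[|[|[|a]]] s IH] //= Hs H; first by rewrite !add0n IH //; lia.
  by case: ifP => /= Hp; [lia | rewrite -IH //; lia].
by case: eqP => /= Hp; [lia | rewrite -IH //; lia].
Qed.

(** After [k] entries the walk stands at height [sumn (take k s) - k]. Hence a zero [peak] keeps
    every prefix sum at most the length of the prefix. *)
Lemma sumn_take_peak s k :
  ternary s -> (sumn (take k s)).*2 <= k.*2 + peak s.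
Proof.
elim: s k => [|[|[|[|a]]] s IH] [|k] //= Hs; have := IH k Hs; lia.
Qed.

(** * Vectors as sequences of entries *)

Section Vectors.

Variable n : nat.
Implicit Types (x y : vec3 n) (F G : {set vec3 n}) (i j k : 'I_n).

Lemma sum_bigD2 (H : 'I_n -> nat) i j : i != j ->
  \sum_k H k = H i + (H j + \sum_(k | (k != i) && (k != j)) H k).
Proof.
by move=> ij; rewrite (bigD1 i) //= (bigD1 j) 1?eq_sym.
Qed.

Definition entries x : seq nat := [seq (x i : nat) | i <- enum 'I_n].

Lemma size_entries x : size (entries x) = n.
Proof. by rewrite size_map size_enum_ord. Qed.

Lemma nth_entries x i : nth 0 (entries x) i = x i.
Proof. by rewrite (nth_map i) ?size_enum_ord // nth_ord_enum. Qed.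

Lemma entries_inj : injective entries.
Proof.
move=> x y exy; apply/ffunP => i; apply: val_inj.
by rewrite /= -!nth_entries exy.
Qed.

Lemma ternary_entries x : ternary (entries x).
Proof. by apply/allP => a /mapP[i _ ->]; have := ltn_ord (x i). Qed.

Lemma sumn_entries x : sumn (entries x) = \sum_i (x i : nat).
Proof. by rewrite sumnE big_map big_enum. Qed.

Lemma sumn_take_entries x m : m <= n ->
  sumn (take m (entries x)) = \sum_(i < n | i < m) (x i : nat).
Proof.
move=> mn; rewrite sumnE (big_nth 0) size_take size_entries.
have -> : (if m < n then m else n) = m by case: ltnP => //; lia.
rewrite big_mkord (big_ord_widen _ _ mn).
by apply: eq_bigr => i im; rewrite nth_take // nth_entries.
Qed.

(** * Swap-closed families *)

Definition swapv i j x : vec3 n := [ffun k => x (tperm i j k)].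

Lemma swapvK i j : involutive (swapv i j).
Proof. by move=> x; apply/ffunP => k; rewrite !ffunE tpermK. Qed.

Lemma msum3_inter_swapv i j x y :
  msum3_inter (swapv i j x) (swapv i j y) = msum3_inter x y.
Proof.
rewrite /msum3_inter [RHS](reindex_inj (@perm_inj _ (tperm i j))).
by apply: eq_bigr => k _; rewrite !ffunE.
Qed.

Lemma msum3_interC x y : msum3_inter x y = msum3_inter y x.
Proof. by apply: eq_bigr => k _; rewrite addnC. Qed.

(** The swap pairs the larger entry of [x] with the larger entry of [y], and max(0, s - 2) is convex
    in s, so the two affected summands do not decrease in total. *)
Lemma msum3_inter_swapv_ge i j x y : x i < x j -> y j <= y i ->
  msum3_inter x y <= msum3_inter (swapv i j x) y.
Proof.
move=> xij yji; have ij : i != j by apply: contraTneq xij => ->; rewrite ltnn.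
rewrite /msum3_inter !(sum_bigD2 _ ij) !ffunE tpermL tpermR.
set A := (X in _ <= _ + (_ + X)).
have -> : \sum_(k | (k != i) && (k != j)) ((x k : nat) + (y k : nat) - 2) = A.
  apply: eq_bigr => k /andP[ki kj].
  by rewrite ffunE tpermD 1?eq_sym.
by lia.
Qed.

Definition shiftv G i j x : vec3 n :=
  if (x i < x j) && (swapv i j x \notin G) then swapv i j x else x.

(** A moved vector lands outside [G] and an unmoved one stays inside, so no moved vector collides
    with an unmoved one. *)
Lemma shiftv_inj G i j : {in G &, injective (shiftv G i j)}.
Proof.
move=> x y xG yG; rewrite /shiftv.
case: ifP => [/andP[_ xN]|_]; case: ifP => [/andP[_ yN]|_] //.
- by move/(can_inj (swapvK i j)).
- by move=> e; rewrite e yG in xN.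
- by move=> e; rewrite -e xG in yN.
Qed.

Lemma shiftv_intersecting t G i j :
  msum3_intersecting t G -> msum3_intersecting t (shiftv G i j @: G).
Proof.
move=> HG.
(* Here [x] moves and [y] stays. If [y] stays because its swap is already in [G], the swap is
   transferred from [x] to [y]. *)
have mixed x y : x \in G -> y \in G -> x i < x j ->
    ~~ ((y i < y j) && (swapv i j y \notin G)) ->
    t <= msum3_inter (swapv i j x) y.
  move=> xG yG xij; rewrite negb_and negbK -leqNgt => /orP[yji|yG'].
    exact: leq_trans (HG _ _ xG yG) (msum3_inter_swapv_ge xij yji).
  by rewrite -(msum3_inter_swapv i j) swapvK; apply: HG.
move=> _ _ /imsetP[x xG ->] /imsetP[y yG ->]; rewrite /shiftv.
case: (boolP ((x i < x j) && _)) => [/andP[xij _]|hx];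
  case: (boolP ((y i < y j) && _)) => [/andP[yij _]|hy].
- by rewrite msum3_inter_swapv; apply: HG.
- exact: mixed.
- by rewrite msum3_interC; apply: mixed.
- exact: HG.
Qed.

(** A potential for the shifts: earlier coordinates count more. *)
Definition weight x : nat := \sum_i (x i : nat) * (n - i).

Lemma weight_swapv i j x : i < j -> x i < x j ->
  weight x < weight (swapv i j x).
Proof.
move=> ltij xij; have ij : i != j by apply: contraTneq ltij => ->; rewrite ltnn.
rewrite /weight !(sum_bigD2 _ ij) !ffunE tpermL tpermR.
set A := (X in _ < _ + (_ + X)).
have -> : \sum_(k | (k != i) && (k != j)) (x k : nat) * (n - k) = A.
  by apply: eq_bigr => k /andP[ki kj]; rewrite ffunE tpermD 1?eq_sym.
have := ltn_ord j; nia.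
Qed.

Definition swap_closed G :=
  forall x i j, x \in G -> i < j -> x i < x j -> swapv i j x \in G.

(** Among the [t]-intersecting families of size [#|F|], one of maximal total weight is swap-closed:
    a missing swap would let [shiftv] increase the total. *)
Lemma swap_closed_exists t F : msum3_intersecting t F ->
  exists G, [/\ #|G| = #|F|, msum3_intersecting t G & swap_closed G].
Proof.
move=> HF.
pose P := [pred G : {set vec3 n} | (#|G| == #|F|) &&
  [forall x in G, forall y in G, t <= msum3_inter x y]].
have interP G : reflect (msum3_intersecting t G)
    [forall x in G, forall y in G, t <= msum3_inter x y].
  apply: (iffP forall_inP) => H x.
    by move=> y xG yG; apply: (forall_inP (H x xG)).
  by move=> xG; apply/forall_inP => y; apply: H.
have PF : P F by rewrite /P /= eqxx; apply/interP.
case: (@arg_maxnP _ F P (fun G : {set vec3 n} => \sum_(x in G) weight x) PF).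
move=> G /andP[/eqP cG /interP iG] maxG; exists G; split=> // x i j xG ltij xij.
apply: contraT => xN.
have PG : P (shiftv G i j @: G).
  rewrite /P /= card_in_imset; last exact: shiftv_inj.
  by rewrite cG eqxx; apply/interP/shiftv_intersecting.
have /= := maxG _ PG; rewrite /geq /= leqNgt => /negP[].
rewrite big_imset; last exact: shiftv_inj.
rewrite (bigD1 x) //= [X in _ < X](bigD1 x) //= -addSn.
apply: leq_add; first by rewrite /shiftv xij xN weight_swapv.
apply: leq_sum => y _; rewrite /shiftv; case: ifP => // /andP[yij _].
exact/ltnW/weight_swapv.
Qed.

(* Vectors reached after the exchange of all matched pairs within the first
   [m] coordinates. *)
Lemma swap_closed_prefix G x m : swap_closed G -> x \in G ->
  peak (entries x) = 0 -> m <= n ->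
  exists y, [/\ y \in G,
    forall i, m <= i -> y i = x i,
    forall i, i < m -> x i + y i = 0 \/ x i + y i = 2 &
    \sum_(i < n | i < m) (y i : nat) = \sum_(i < n | i < m) (x i : nat)].
Proof.
move=> clG xG px; elim: m => [_|m IH mn]; first by exists x; split.
have [y [yG yge ylt ysum]] := IH (ltnW mn).
pose k := Ordinal mn.
have sumS (z : vec3 n) : \sum_(i < n | i < m.+1) (z i : nat) =
    z k + \sum_(i < n | i < m) (z i : nat).
  rewrite (bigD1 k) //=; congr addn; apply: eq_bigl => i.
  by rewrite -val_eqE /= ltnS; lia.
have ltS (i : 'I_n) : i < m.+1 -> i != k -> i < m.
  by rewrite -val_eqE /=; lia.
have yk : y k = x k by apply: yge.
have [xk2|xk2] := eqVneq (x k : nat) 2; last first.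
  have [xk0|xk1] : (x k : nat) = 0 \/ (x k : nat) = 1.
  - by have := ltn_ord (x k); lia.
  - exists y; split=> //; first by move=> i /ltnW; apply: yge.
      move=> i im; have [->|/(ltS _ im)/ylt//] := eqVneq i k.
      by rewrite yk xk0; left.
    by rewrite !sumS ysum yk.
  - exists y; split=> //; first by move=> i /ltnW; apply: yge.
      move=> i im; have [->|/(ltS _ im)/ylt//] := eqVneq i k.
      by rewrite yk xk1; right.
    by rewrite !sumS ysum yk.
(* An earlier unmatched 0 exists. Otherwise [x i + y i = 2] for all [i < m], and equal prefix sums
   force the sum of [x] over [i < m] to be [m]; the entry 2 at [k] then gives [m + 2] over [m + 1]
   coordinates, against the zero peak. *)
have [i im xyi] : exists2 i : 'I_n, i < m & x i + y i = 0.
  have sumx : (\sum_(i < n | i < m) (x i : nat)).+1 <= m.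
    have := sumn_take_peak m.+1 (ternary_entries x).
    rewrite px sumn_take_entries // sumS xk2; lia.
  case: (boolP [exists i : 'I_n, (i < m) && (x i + y i == 0)]).
    by case/existsP=> i /andP[im /eqP e]; exists i.
  rewrite negb_exists => /forallP H.
  have : \sum_(i < n | i < m) 2 <= \sum_(i < n | i < m) (x i + y i).
    apply: leq_sum => i im.
    by have := H i; rewrite im /=; case: (ylt i im) => ->.
  rewrite big_split /= ysum -(big_ord_widen _ (fun=> 2) (ltnW mn)).
  by rewrite sum_nat_const card_ord addnn muln2 leq_double leqNgt sumx.
have [xi yi] : (x i : nat) = 0 /\ (y i : nat) = 0 by lia.
have ik : i != k by rewrite -val_eqE /=; lia.
have swapE l : swapv i k y l = if l == i then y k else if l == k then y i else y l.
  by rewrite ffunE; case: tpermP => [->|->|/eqP/negPf-> /eqP/negPf->//];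
    rewrite ?eqxx // eq_sym (negPf ik).
(* Matching [i] with [k] moves the 2 of [y] from [k] to [i], so [x] and the new vector add up to 2
   at both places. *)
exists (swapv i k y); split.
- by apply: clG => //; rewrite yi yk xk2.
- move=> l ml; rewrite swapE !ifN; first by apply: yge; apply: ltnW.
    by rewrite -val_eqE /=; lia.
  by rewrite -val_eqE /=; lia.
- move=> l lm; rewrite swapE; case: eqVneq => [->|li].
    by rewrite xi yk xk2; right.
  case: eqVneq => [->|/(ltS _ lm)/ylt//].
  by rewrite yi xk2; right.
- rewrite !sumS -ysum (bigD1 i) //= [in RHS](bigD1 i) //= !swapE eqxx.
  rewrite eq_sym (negPf ik) eqxx yi yk add0n.
  rewrite add0n; congr addn; apply: eq_bigr => l /andP[lm li].
  rewrite swapE (negPf li) ifN // -val_eqE /=; lia.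
Qed.

Lemma swap_closed_peak_gt0 G x : swap_closed G -> msum3_intersecting 1 G ->
  x \in G -> 0 < peak (entries x).
Proof.
move=> clG iG xG; rewrite lt0n; apply/eqP => px.
(* With [m = n] the exchange covers all coordinates, so every truncated summand [x i + y i - 2]
   vanishes. *)
have [y [yG _ H _]] := swap_closed_prefix clG xG px (leqnn n).
have := iG _ _ xG yG; rewrite /msum3_inter big1 // => i _.
by case: (H i (ltn_ord i)) => ->.
Qed.

(** * The injection *)

(** The argument of [inord] is at most 2, so its default value never occurs. *)
Definition colower x : vec3 n :=
  [ffun i : 'I_n => inord (2 - nth 0 (lower (entries x)) i)].

Lemma nth_lower_entries x i : nth 0 (lower (entries x)) i <= x i.
Proof. by rewrite -nth_entries nth_lower_le. Qed.

Lemma colowerE x i : colower x i = 2 - nth 0 (lower (entries x)) i :> nat.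
Proof. by rewrite ffunE inordK // ltnS leq_subr. Qed.

Lemma sum_lower_entries x : 0 < peak (entries x) ->
  (\sum_(i < n) nth 0 (lower (entries x)) i).+1 = \sum_i (x i : nat).
Proof.
move=> px; rewrite -sumn_entries -sumn_lower ?ternary_entries //.
by rewrite [in RHS]sumnE [in RHS](big_nth 0) size_lower size_entries big_mkord.
Qed.

Lemma sum_colower x : 0 < peak (entries x) ->
  \sum_i (colower x i : nat) + \sum_i (x i : nat) = (2 * n).+1.
Proof.
move=> px; rewrite -(sum_lower_entries px) addnS -big_split /=.
rewrite (eq_bigr (fun=> 2)) ?sum_nat_const ?card_ord 1?mulnC // => i _.
have := nth_lower_entries x i; have := ltn_ord (x i).
rewrite colowerE; lia.
Qed.

(** Each summand is the drop from [x i] to the lowered entry, and the drops add up to 1. *)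
Lemma msum3_inter_colower x : 0 < peak (entries x) ->
  msum3_inter x (colower x) = 1.
Proof.
move=> px; apply/eqP.
rewrite -(eqn_add2r (\sum_(i < n) nth 0 (lower (entries x)) i)) add1n.
rewrite sum_lower_entries // -big_split /=; apply/eqP/eq_bigr => i _.
have := nth_lower_entries x i; have := ltn_ord (x i).
rewrite colowerE; lia.
Qed.

Lemma colower_inj :
  {in [pred x | 0 < peak (entries x)] &, injective colower}.
Proof.
move=> x y; rewrite !inE => px py exy; apply: entries_inj.
rewrite -(lowerK (ternary_entries x) px) -(lowerK (ternary_entries y) py).
congr raise; apply: (@eq_from_nth _ 0); rewrite !size_lower !size_entries //.
move=> m mn; have := colowerE x (Ordinal mn); rewrite exy colowerE /=.
have := nth_lower_entries x (Ordinal mn); have := ltn_ord (x (Ordinal mn)).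
have := nth_lower_entries y (Ordinal mn); have := ltn_ord (y (Ordinal mn)).
by move=> /=; lia.
Qed.

Lemma swap_closed_card G : swap_closed G -> msum3_intersecting 2 G ->
  #|G| <= #|[set x : vec3 n | n < \sum_i (x i : nat)]|.
Proof.
move=> clG iG; set U := [set x | _].
have pG x : x \in G -> 0 < peak (entries x).
  by apply: swap_closed_peak_gt0 => // y z yG zG; apply: ltnW (iG _ _ yG zG).
(* After cancelling the common part of [G] and [U], it remains to inject [G :\: U] into
   [U :\: G]. *)
rewrite -(cardsID U G) -(cardsID G U) setIC leq_add2l.
rewrite -(@card_in_imset _ _ colower); last first.
  move=> x y /setDP[xG _] /setDP[yG _]; apply: colower_inj; exact: pG.
apply/subset_leq_card/subsetP => _ /imsetP[x /setDP[xG xU] ->].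
apply/setDP; split.
  have := sum_colower (pG x xG); move: xU; rewrite !inE; lia.
apply/negP => cG; have := iG _ _ xG cG.
by rewrite msum3_inter_colower ?pG.
Qed.

Lemma bigcup_layer2_upper :
  [set x : vec3 n | n < \sum_i (x i : nat)]
    \subset \bigcup_(n.+1 <= r < (2 * n).+1) layer2 n r.
Proof.
apply/subsetP => x; rewrite inE => xn.
have xle : \sum_i (x i : nat) <= 2 * n.
  rewrite mulnC -[X in X * 2]card_ord -sum_nat_const.
  by apply: leq_sum => i _; have := ltn_ord (x i).
rewrite (bigD1_seq (\sum_i (x i : nat))) ?iota_uniq //=; last first.
  by rewrite mem_index_iota xn ltnS xle.
by rewrite !inE eqxx.
Qed.

End Vectors.

Theorem theorem4p3 (n : nat) (F : {set vec3 n}) :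
  1 <= n -> msum3_intersecting 2 F ->
  #|F| <= #|\bigcup_(n.+1 <= r < (2 * n).+1) layer2 n r|.
Proof.
move=> _ /swap_closed_exists[G [<- iG clG]].
apply: leq_trans (swap_closed_card clG iG) _.
exact/subset_leq_card/bigcup_layer2_upper.
Qed.
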